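(* Let $E,Z$ be Banach spaces, $K\subset Z$ a closed convex cone with nonempty interior, $X\subset E$ convex, $f:X\to\mathbb{R}$ convex and $g:X\to Z$ $K$-convex. Consider the primal problem (P): minimize $f(x)$ subject to $x\in X$, $g(x)\preceq_K0$, and the dual problem (D): maximize $\inf_{x\in X}\{f(x)+\langle u^*,g(x)\rangle\}$ over $u^*\in K^+$. Let $v(z):=\inf\{f(x):x\in X,\ g(x)\preceq_K z\}$ for $z\in Z$, and suppose $v(0)$ is finite. Let $\bar u^*\in Z^*$. Then ($\bar u^*$ is an optimal solution of (D) and the optimal values of (P) and (D) are equal) if and only if $-\bar u^*\in\partial v(0)$.
   Context: Order notation: $z_1\preceq_K z_2$ means $z_2-z_1\in K$. $g$ is $K$-convex if $g(\lambda x_1+(1-\lambda)x_2)\preceq_K\lambda g(x_1)+(1-\lambda)g(x_2)$ for all $x_1,x_2\in X$, $\lambda\in[0,1]$. $K^+:=\{z^*\in Z^*:\langle z^*,z\rangle\ge0\ \forall z\in K\}$. Convention $\inf\emptyset=+\infty$; $v$ takes values in $\mathbb{R}\cup\{\pm\infty\}$, and the optimal value of (P) is $v(0)$. For $v(0)\in\mathbb{R}$, $\partial v(0):=\{z^*\in Z^*:\langle z^*,z\rangle\le v(z)-v(0)\ \forall z\in Z\}$. *)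

(* Defs.v *)
From HB Require Import structures.
From mathcomp Require Import all_boot all_order all_algebra.
From mathcomp Require Import all_classical all_reals all_analysis.

Set Implicit Arguments.
Unset Strict Implicit.
Unset Printing Implicit Defensive.

Import Order.TTheory GRing.Theory Num.Theory.
Import numFieldNormedType.Exports.

Local Open Scope classical_set_scope.
Local Open Scope ring_scope.

(* The topological dual Z^*, as a set of functions; R^o is R as a module over
   itself. *)
Definition dual_space (R : realType) (Z : normedModType R) : set (Z -> R) :=
  [set u | linear (u : Z -> R^o) /\ continuous u].
Arguments dual_space {R} Z _.

(* Cones are stable under multiplication by nonnegative scalars. For nonempty
   closed K this is the same as stability under positive ones. *)
Definition cone (R : realType) (Z : lmodType R) (K : set Z) : Prop :=
  forall (t : R) (z : Z), 0 <= t -> K z -> K (t *: z).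

Definition cone_le (R : realType) (Z : lmodType R) (K : set Z) (z1 z2 : Z) :
  Prop := K (z2 - z1).

(* Only the values of g on X matter. *)
Definition cone_convex (R : realType) (E Z : lmodType R) (K : set Z)
    (X : set E) (g : E -> Z) : Prop :=
  forall (x1 x2 : E) (t : R), X x1 -> X x2 -> 0 <= t -> t <= 1 ->
    cone_le K (g (t *: x1 + (1 - t) *: x2)) (t *: g x1 + (1 - t) *: g x2).

Definition dual_cone (R : realType) (Z : normedModType R) (K : set Z) :
    set (Z -> R) :=
  [set u | dual_space Z u /\ forall z : Z, K z -> 0 <= u z].

Section ConvexProgram.
Context (R : realType) (E Z : normedModType R).
Variables (K : set Z) (X : set E) (f : E -> R) (g : E -> Z).
Local Open Scope ereal_scope.

(* [ereal_inf set0 = +oo]. *)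
Definition value_function (z : Z) : \bar R :=
  ereal_inf [set (f x)%:E | x in [set x | X x /\ cone_le K (g x) z]].

Definition primal_value : \bar R := value_function 0%R.

Definition dual_objective (u : Z -> R) : \bar R :=
  ereal_inf [set (f x + u (g x))%:E | x in X].

Definition dual_value : \bar R :=
  ereal_sup [set dual_objective u | u in dual_cone K].

Definition dual_optimal (u : Z -> R) : Prop :=
  dual_cone K u /\
  forall w : Z -> R, dual_cone K w -> dual_objective w <= dual_objective u.

End ConvexProgram.

(* Subdifferential at the origin of an extended-real-valued function; it is
   meaningful when [v 0] is finite. *)
Definition subdifferential0 (R : realType) (Z : normedModType R)
    (v : Z -> \bar R) : set (Z -> R) :=
  [set u | dual_space Z u /\ forall z : Z, ((u z)%:E <= v z - v 0%R)%E].

(* Main.v *)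
(** By weak duality every value of (D) is at most [v 0], so the left-hand side
    says that [ubar] lies in the dual cone and [v 0 <= f x + ubar (g x)] on [X].
    If [g x] is below [z] then [ubar (g x) <= ubar z], whence
    [v 0 - ubar z <= v z]. Conversely, test the subgradient inequality at the
    points of [K], where [v z <= v 0], and at the points [g x], where
    [v (g x) <= f x]. *)
Require Import Defs.
From HB Require Import structures.
From mathcomp Require Import all_boot all_order all_algebra.
From mathcomp Require Import all_classical all_reals all_analysis.

Set Implicit Arguments.
Unset Strict Implicit.
Unset Printing Implicit Defensive.

Import Order.TTheory GRing.Theory Num.Theory.
Import numFieldNormedType.Exports.

Local Open Scope classical_set_scope.
Local Open Scope ring_scope.

Section DualSpace.
Context (R : realType) (Z : normedModType R).
Implicit Types (u : Z -> R) (a b : Z).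

Lemma dual_spaceB u a b : dual_space Z u -> u (a - b) = u a - u b.
Proof.
(* [linear] speaks of [c *: a + b], so the difference is read as [-1 *: b + a]. *)
move=> [lin_u _]; rewrite addrC -scaleN1r lin_u.
by rewrite scaleN1r addrC.
Qed.

Lemma dual_spaceN u : dual_space Z u -> dual_space Z (- u).
Proof.
move=> [lin_u cont_u]; split => [c a b | a]; last exact: continuousN (cont_u a).
by rewrite !fctE lin_u opprD scalerN.
Qed.

End DualSpace.

Section Cone.
Context (R : realType) (Z : lmodType R) (K : set Z).
Hypothesis (K_cone : cone K).

Lemma cone0 : K !=set0 -> K 0.
Proof. by move=> [z /(K_cone (lexx 0))]; rewrite scale0r. Qed.

(** The sum is twice the midpoint of [a] and [b]: convexity puts the midpoint in [K], and scaling by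
    2 keeps it there. *)
Lemma cone_convexD (a b : Z) :
  convex_set (K : set (convex_lmodType Z)) -> K a -> K b -> K (a + b).
Proof.
move=> K_convex Ka Kb.
have half_le1 : 2^-1 <= 1 :> R by rewrite invf_le1 ?ler1n.
have half_ge0 : 0 <= 2^-1 :> R by rewrite invr_ge0.
have /set_mem/(K_cone (ler0n R 2)) :=
  K_convex a b (Itv01 half_ge0 half_le1) (mem_set Ka) (mem_set Kb).
rewrite /conv /= /unstable.onem scalerDr !scalerA mulrBr mulr1 divff// addrK.
by rewrite !scale1r.
Qed.

End Cone.

Lemma dual_cone_le (R : realType) (Z : normedModType R) (K : set Z)
    (u : Z -> R) (z1 z2 : Z) :
  dual_cone K u -> cone_le K z1 z2 -> u z1 <= u z2.
Proof. by move=> [du u_ge0] /u_ge0; rewrite dual_spaceB// subr_ge0. Qed.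

Section Duality.
Context (R : realType) (E Z : normedModType R).
Variables (K : set Z) (X : set E) (f : E -> R) (g : E -> Z).
Local Open Scope ereal_scope.

Let v := value_function K X f g.

Lemma value_function_le x z : X x -> cone_le K (g x) z -> v z <= (f x)%:E.
Proof. by move=> Xx gxz; apply: ereal_inf_lbound; exists x. Qed.

Lemma dual_objectiveP (u : Z -> R) (c : \bar R) :
  (forall x, X x -> c <= (f x + u (g x))%:E) <-> c <= dual_objective X f g u.
Proof.
split => [cle | cle x Xx].
  by apply: le_ereal_inf_tmp => _ [x Xx <-]; exact: cle.
by apply: le_trans cle _; apply: ereal_inf_lbound; exists x.
Qed.

(** Every [x] feasible for [z] has [u (g x) <= u z], so the dual objective is at most [f x + u z]. A
    finite dual objective is thus the value at 0 of an affine minorant of [v] with slope [-u]. *)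
Lemma dual_objective_le (u : Z -> R) (z : Z) :
  dual_cone K u -> dual_objective X f g u - (u z)%:E <= v z.
Proof.
move=> Ku; apply: le_ereal_inf_tmp => _ [x [Xx gxz] <-].
rewrite leeBlDr//.
have /dual_objectiveP/(_ x Xx)/le_trans := lexx (dual_objective X f g u); apply.
by rewrite -EFinD lee_fin lerD2l; exact: dual_cone_le gxz.
Qed.

Lemma weak_duality (u : Z -> R) :
  dual_cone K u -> dual_objective X f g u <= v 0%R.
Proof.
move=> Ku; have := dual_objective_le (0%R : Z) Ku.
(* Additivity at [0 - 0] gives [u 0 = 0]. *)
by have := dual_spaceB (0%R : Z) 0%R Ku.1; rewrite !subrr => ->; rewrite sube0.
Qed.

Hypotheses (K_cone : cone K) (K_neq0 : K !=set0).
Hypothesis K_convex : convex_set (K : set (convex_lmodType Z)).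

(** Since [z2 - g x] is the sum of [z2 - z1] and [z1 - g x], both in [K], passing from [z1] to [z2]
    enlarges the feasible set. *)
Lemma value_function_nonincreasing (z1 z2 : Z) :
  cone_le K z1 z2 -> v z2 <= v z1.
Proof.
move=> z12; apply: le_ereal_inf_tmp => _ [x [Xx gxz] <-].
apply: value_function_le => //; rewrite /cone_le -(subrKA z1).
exact: cone_convexD.
Qed.

Hypothesis v0_fin : v 0%R \is a fin_num.

(** For [u] in the dual cone, weak duality makes [v 0 <= dual_objective X f g u] equivalent to
    optimality with zero gap. *)
Lemma subdifferential0_valueP (u : Z -> R) : dual_space Z u ->
  (dual_cone K u /\ v 0%R <= dual_objective X f g u) <->
  subdifferential0 v (- u)%R.
Proof.
move=> du; split => [[Ku v0_le] | [_ sub_u]].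
  split => [|z]; first exact: dual_spaceN.
  (* [v 0] can change sides because it is finite, whereas [v z] may be infinite. *)
  rewrite leeBrDl// EFinN; apply: le_trans (dual_objective_le z Ku).
  exact: leeB.
split.
  split => // z Kz; rewrite -oppr_le0 -lee_fin.
  apply: le_trans (sub_u z) _; rewrite leeBlDl// adde0.
  by apply: value_function_nonincreasing; rewrite /cone_le subr0.
apply/dual_objectiveP => x Xx.
rewrite EFinD -leeBlDr// -EFinN addeC.
have := sub_u (g x); rewrite leeBrDl// addeC => /le_trans; apply.
(* The point [x] is feasible for the perturbation [g x] because [K] contains 0. *)
by apply: value_function_le => //; rewrite /cone_le subrr; exact: cone0.
Qed.

End Duality.

Theorem proposition3p6 (R : realType) (E Z : completeNormedModType R)
    (K : set Z) (X : set E) (f : E -> R) (g : E -> Z)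
    (K_closed : closed K)
    (K_convex : convex_set (K : set (convex_lmodType Z)))
    (K_cone : cone K)
    (K_interior : K° !=set0)
    (X_convex : convex_set (X : set (convex_lmodType E)))
    (f_convex : convex_function (X : set (convex_lmodType E)) f)
    (g_convex : cone_convex K X g)
    (v0_finite : value_function K X f g 0 \is a fin_num)
    (ubar : Z -> R) (ubar_dual : dual_space Z ubar) :
  (dual_optimal K X f g ubar /\
     primal_value K X f g = dual_value K X f g)
  <-> subdifferential0 (value_function K X f g) (- ubar).
Proof.
have K_neq0 : K !=set0.
  by case: K_interior => z /interior_subset Kz; exists z.
apply: iff_trans (subdifferential0_valueP K_cone K_neq0 K_convex v0_finite _)
  => //.
split => [[[Ku u_max] v0E] | [Ku v0_le]].
  (* The zero gap replaces [v 0] by the supremum of (D), which the value at [ubar] bounds from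
     above. *)
  split => //; rewrite -/(primal_value K X f g) v0E.
  by apply: ge_ereal_sup => _ [w Kw <-]; exact: u_max.
(* [v 0] lies between any dual value and the value at [ubar]. *)
have u_max w : dual_cone K w ->
    (dual_objective X f g w <= dual_objective X f g ubar)%E.
  by move=> Kw; apply: le_trans (weak_duality _ _ _ Kw) v0_le.
split => //; apply/eqP; rewrite eq_le; apply/andP; split.
  by apply: le_trans v0_le _; apply: ereal_sup_ubound; exists ubar.
by apply: ge_ereal_sup => _ [w Kw <-]; exact: weak_duality.
Qed.
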